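(* Let $\theta\in(0,1)$ be irrational with $\theta^2=1/m$ for some $m\in\mathbb{N}_+$. Let $\{a(n)\}_{n\ge1}$ be a sequence of positive numbers such that $a(n)/n$ is non-decreasing. Then for $\gamma_\theta$-almost every $x\in[0,\theta]$: if $\sum_{n=1}^\infty 1/a(n)<\infty$ then $\lim_{n\to\infty}S_{n,\theta}(x)/a(n)=0$, and if $\sum_{n=1}^\infty 1/a(n)=\infty$ then $\limsup_{n\to\infty}S_{n,\theta}(x)/a(n)=\infty$.
   Context: Let $m\in\mathbb{N}_+$ not be a perfect square and $\theta=1/\sqrt m\in(0,1)$. The map $T_\theta:[0,\theta]\to[0,\theta]$ is $T_\theta(x)=\frac1x-\theta\lfloor\frac{1}{\theta x}\rfloor$ for $x\in(0,\theta]$ and $T_\theta(0)=0$. The digits of $x$ are $\ell_n(x)=\lfloor \frac{1}{\theta T_\theta^{n-1}(x)}\rfloor$ for $n\ge1$ (with $T_\theta^0(x)=x$); they take values in $\{m,m+1,\dots\}$ and are defined for almost every $x$. The probability measure $\gamma_\theta$ on $[0,\theta]$ has density $\frac{1}{\log(1+\theta^2)}\cdot\frac{\theta}{1+\theta x}$ with respect to Lebesgue measure; it is $T_\theta$-invariant and ergodic. Define $S_{n,\theta}(x)=\sum_{k=1}^n\ell_k(x)$. *)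

(* Defs.v *)
From HB Require Import structures.
From mathcomp Require Import all_boot all_order all_algebra.
From mathcomp Require Import all_classical all_reals all_analysis.
Set Implicit Arguments. Unset Strict Implicit. Unset Printing Implicit Defensive.
Import Order.TTheory GRing.Theory Num.Theory.
Local Open Scope classical_set_scope.
Local Open Scope ring_scope.

Section Defs.
Variable R : realType.

Definition theta (m : nat) : R := (Num.sqrt (m%:R))^-1.

Definition Ttheta (m : nat) (x : R) : R :=
  if x == 0 then 0
  else x^-1 - theta m * (Num.floor ((theta m * x)^-1))%:~R.

Definition digit (m : nat) (n : nat) (x : R) : int :=
  Num.floor ((theta m * iter n.-1 (Ttheta m) x)^-1).

Definition Ssum (m : nat) (n : nat) (x : R) : R :=
  \sum_(1 <= k < n.+1) (digit m k x)%:~R.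

Definition gamma_density (m : nat) (x : R) : R :=
  (ln (1 + theta m ^+ 2))^-1 * (theta m / (1 + theta m * x)).

Definition gamma_theta (m : nat) (A : set R) : \bar R :=
  \int[@lebesgue_measure R]_(x in A `&` `[0, theta m]%classic) (gamma_density m x)%:E.

Definition gamma_ae (m : nat) (P : R -> Prop) : Prop :=
  exists N : set R, [/\ measurable N, gamma_theta m N = 0%E &
    [set x | `[0, theta m]%classic x /\ ~ P x] `<=` N].

End Defs.

(* Main.v *)
Require Import Defs.
From HB Require Import structures.
From mathcomp Require Import all_boot all_order all_algebra.
From mathcomp Require Import all_classical all_reals all_analysis.
From mathcomp Require Import measurable_realfun.
From mathcomp Require Import ring lra zify.
Import Order.TTheory GRing.Theory Num.Theory numFieldNormedType.Exports.
Local Open Scope classical_set_scope.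
Local Open Scope ring_scope.

(** The points whose first digits form a word [w] lie in the image of
    [0, theta] under a Moebius map, an interval of length
    [theta / (q (q + theta q'))] with [q, q'] the continued fraction
    denominators of [w].  Splitting this interval according to the next digit
    telescopes, and given [w] the probability that the next digit is at least
    [l] is between [m / (l + 1)] and [2 m / l].  A nonnegative function on words
    that is a supermartingale for these cylinder lengths bounds the measure of
    the set of points whose word satisfies a given property.

    If [sum 1 / a n] diverges, the set where [digit k < K a k] for all
    [1 <= k <= n] has measure [O (1 / (1 + sum_(k <= n) 1 / (3 K a k)))], so
    almost every [x] has some [digit n >= K a n], for every [K].

    If it converges, consider the first [2 ^ (j + 1)] digits and the level
    [t = min (a (2 ^ j)) (4 ^ j)].  The square of the positive part of the sum
    of the digits truncated at [t], centred at [n c] where [c] is twice a bound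
    for the conditional mean, plus [t ^ 2] times the number of digits above [t],
    grows on average by [O t] per digit.  By Markov's inequality the digit sum
    exceeds [delta t] with probability [O (2 ^ j / t)], as soon as
    [n c <= delta t / 2]; these probabilities are summable and Borel-Cantelli
    applies. *)

Set Implicit Arguments.
Unset Strict Implicit.
Unset Printing Implicit Defensive.

(** * Continuants and lengths of cylinders *)

Section Cylinders.
Variables (R : realType) (m : nat).
Hypothesis m_gt0 : (0 < m)%N.
Local Notation th := (theta R m).

Lemma theta_gt0 : 0 < th.
Proof. by rewrite invr_gt0 sqrtr_gt0 ltr0n. Qed.

Lemma theta_sqr : th ^+ 2 * m%:R = 1.
Proof. by rewrite exprVn sqr_sqrtr ?ler0n// mulVf// pnatr_eq0 -lt0n. Qed.

Lemma theta_le1 : th <= 1.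
Proof.
have h := theta_sqr; have t0 := theta_gt0.
have m1 : 1 <= m%:R :> R by rewrite ler1n.
by rewrite leNgt; apply/negP => t1; nra.
Qed.

(* Words list the most recent digit first, so that the continuant recursion is
   structural. *)
Fixpoint contn (c : R * R) (w : seq nat) : R * R :=
  if w is l :: w' then
    let d := contn c w' in (th * l%:R * d.1 + d.2, d.1)
  else c.

Definition cden (w : seq nat) : R := (contn (1, 0) w).1.
Definition cden' (w : seq nat) : R := (contn (1, 0) w).2.
Definition cnum (w : seq nat) : R := (contn (0, 1) w).1.
Definition cnum' (w : seq nat) : R := (contn (0, 1) w).2.

Definition admissible (w : seq nat) := all (fun l => m <= l)%N w.

Lemma cden_cons l w : cden (l :: w) = th * l%:R * cden w + cden' w.
Proof. by []. Qed.

Lemma cden'_cons l w : cden' (l :: w) = cden w.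
Proof. by []. Qed.

(** As [th ^+ 2 * m = 1], a new digit [l >= m] gives [th * cden (l :: w) >= th ^+ 2 * m * cden w =
    cden w]. *)
Lemma cden_bounds w : admissible w ->
  [/\ 0 < cden w, 0 <= cden' w & cden' w <= th * cden w].
Proof.
have t0 := theta_gt0; have tm := theta_sqr.
elim: w => [|l w IH] /=.
  by rewrite /cden /cden' /= ltr01 lexx mulr1 ltW.
move=> /andP[ml /IH[q0 q'0 q'q]]; rewrite cden_cons cden'_cons.
have : m%:R <= l%:R :> R by rewrite ler_nat.
have : 0 < m%:R :> R by rewrite ltr0n.
move: (m%:R) (l%:R) (cden w) (cden' w) tm q0 q'0 q'q => M L q q' tm q0 q'0 q'q M0 ML.
have L0 : 0 < L by exact: lt_le_trans ML.
have qL : 0 < th * L * q by rewrite !mulr_gt0.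
split; [lra | lra |].
rewrite mulrDr !mulrA -expr2.
have : 0 <= th * q' by rewrite mulr_ge0// ltW.
have : th ^+ 2 * M * q <= th ^+ 2 * L * q.
  by rewrite ler_wpM2r ?(ltW q0)// ler_wpM2l// sqr_ge0.
rewrite tm; lra.
Qed.

(** Each new digit only flips the sign of the determinant. *)
Lemma contn_det w : `|cnum w * cden' w - cnum' w * cden w| = 1.
Proof.
rewrite /cnum /cnum' /cden /cden'.
elim: w => [|l w] /=; first by rewrite mul0r mul1r sub0r normrN normr1.
move=> IH; rewrite -[RHS]IH -normrN; congr `|_|; ring.
Qed.

Definition clen (w : seq nat) : R := th / (cden w * (cden w + th * cden' w)).

(** For [l >= m], the length of the image of [[0, 1 / (th * l)]] under the Moebius map of [w]: there
    the next digit is at least [l]. *)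
Definition ctail (w : seq nat) (l : nat) : R :=
  (cden w * (th * l%:R * cden w + cden' w))^-1.

Lemma clen_gt0 w : admissible w -> 0 < clen w.
Proof.
move=> /cden_bounds[q0 q'0 _]; have t0 := theta_gt0.
by rewrite divr_gt0// mulr_gt0// ltr_wpDr// mulr_ge0// ltW.
Qed.

Lemma clen_ge0 w : admissible w -> 0 <= clen w.
Proof. by move=> /clen_gt0/ltW. Qed.

Lemma clen_nil : clen [::] = th.
Proof. by rewrite /clen /cden /cden' /= mulr0 addr0 mulr1 divr1. Qed.

Lemma clen_cons w l : admissible w -> (0 < l)%N ->
  clen (l :: w) = ctail w l - ctail w l.+1.
Proof.
move=> /cden_bounds[q0 q'0 _]; have t0 := theta_gt0.
rewrite -(ltr0n R) => l0.
rewrite /clen /ctail cden_cons cden'_cons -natr1.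
have h1 : 0 < th * l%:R * cden w by rewrite !mulr_gt0.
have h2 : 0 < th * cden w by rewrite !mulr_gt0.
by field; rewrite ?gt_eqF//; nra.
Qed.

Lemma ctail_first w : admissible w -> ctail w m = clen w.
Proof.
move=> /cden_bounds[q0 q'0 _]; have t0 := theta_gt0.
have tm := theta_sqr.
rewrite /clen /ctail.
have -> : th * m%:R = th^-1.
  by apply: (mulfI (lt0r_neq0 t0)); rewrite mulrA -expr2 tm divff// gt_eqF.
have h2 : 0 <= th * cden' w by rewrite mulr_ge0// ltW.
by field; rewrite ?gt_eqF//; nra.
Qed.

Lemma ctail_ge0 w l : admissible w -> 0 <= ctail w l.
Proof.
move=> /cden_bounds[q0 q'0 _]; have t0 := theta_gt0.
rewrite invr_ge0; apply: mulr_ge0; first exact: ltW.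
by rewrite addr_ge0// !mulr_ge0// ltW.
Qed.

Lemma ctail_homo w : admissible w ->
  {in [pred l | 0 < l]%N &, {homo ctail w : k l / (k <= l)%N >-> l <= k}}.
Proof.
move=> /cden_bounds[q0 q'0 _] k l k0 _ kl; have t0 := theta_gt0.
have : 0 < k%:R :> R by rewrite ltr0n.
have : k%:R <= l%:R :> R by rewrite ler_nat.
move=> {}kl {}k0; rewrite /ctail.
have h : 0 < th * k%:R * cden w by rewrite !mulr_gt0.
rewrite lef_pV2 ?posrE.
- by rewrite ler_pM2l// lerD2r ler_pM2r// ler_pM2l.
- by rewrite mulr_gt0// ltr_wpDr// !mulr_gt0// (lt_le_trans k0).
- by rewrite mulr_gt0// ltr_wpDr// !mulr_gt0.
Qed.

(** With [q, q'] the denominators, [m * th * q ^+ 2 * clen w] equals [q / (q + th * q')], where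
    [0 <= th * q' <= q]. *)
Lemma clen_bounds w : admissible w ->
  1 <= 2 * m%:R * th * cden w ^+ 2 * clen w /\
  m%:R * th * cden w ^+ 2 * clen w <= 1.
Proof.
move=> /cden_bounds[q0 q'0 q'q]; have t0 := theta_gt0; have t1 := theta_le1.
have tm := theta_sqr; rewrite /clen.
set q := cden w in q0 q'q *; set q' := cden' w in q'0 q'q *.
have h : 0 <= th * q' by rewrite mulr_ge0// ltW.
have qq : 0 < q + th * q' by lra.
have E : m%:R * th * q ^+ 2 * (th / (q * (q + th * q'))) = q / (q + th * q').
  transitivity (th ^+ 2 * m%:R * q / (q + th * q')); last by rewrite tm mul1r.
  by field; rewrite ?gt_eqF.
split.
  rewrite -!(mulrA 2) E.
  rewrite mulrA ler_pdivlMr// mul1r.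
  have : th * q' <= 1 * (1 * q).
    apply: ler_pM => //; first exact: ltW.
    by apply: (le_trans q'q); rewrite ler_pM2r.
  lra.
by rewrite E ler_pdivrMr//; lra.
Qed.

Lemma ctail_le w l : admissible w -> (0 < l)%N ->
  ctail w l <= 2 * m%:R / l%:R * clen w.
Proof.
move=> aw; have [c1 _] := clen_bounds aw.
move: (aw) => /cden_bounds[q0 q'0 q'q]; have t0 := theta_gt0.
rewrite -(ltr0n R) => l0; rewrite /ctail.
have h : 0 < th * l%:R * cden w by rewrite !mulr_gt0.
rewrite -[leLHS]mul1r ler_pdivrMr; last by rewrite mulr_gt0//; lra.
apply: (le_trans c1).
have -> : 2 * m%:R * th * cden w ^+ 2 * clen w
   = 2 * m%:R / l%:R * clen w * (cden w * (th * l%:R * cden w)).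
  by field; rewrite gt_eqF.
apply: ler_wpM2l.
  by apply: mulr_ge0 (clen_ge0 aw); rewrite divr_ge0.
by rewrite ler_pM2l// lerDl.
Qed.

(** The [l.+1] comes from [cden' w <= th * cden w], which bounds the new continuant by
    [th * (l + 1) * cden w]. *)
Lemma ctail_ge w l : admissible w -> (0 < l)%N ->
  m%:R / l.+1%:R * clen w <= ctail w l.
Proof.
move=> aw; have [_ c1] := clen_bounds aw.
move: (aw) => /cden_bounds[q0 q'0 q'q]; have t0 := theta_gt0.
rewrite -(ltr0n R) => l0; rewrite /ctail -natr1.
have h : 0 < th * l%:R * cden w by rewrite !mulr_gt0.
rewrite -[leRHS]mul1r ler_pdivlMr; last by rewrite mulr_gt0//; lra.
apply: le_trans c1.
have -> : m%:R * th * cden w ^+ 2 * clen w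
   = m%:R / (l%:R + 1) * clen w * (cden w * (th * (l%:R + 1) * cden w)).
  by field; rewrite gt_eqF// addr_gt0.
apply: ler_wpM2l.
  by apply: mulr_ge0 (clen_ge0 aw); rewrite divr_ge0// ler0n.
by rewrite ler_pM2l//; lra.
Qed.

(** Both factors in the denominator of [clen (l :: w)] are at least [th * l * cden w]. *)
Lemma clen_cons_le w l : admissible w -> (0 < l)%N ->
  clen (l :: w) <= 2 * m%:R / l%:R ^+ 2 * clen w.
Proof.
move=> aw; have [c1 _] := clen_bounds aw.
move: (aw) => /cden_bounds[q0 q'0 q'q]; have t0 := theta_gt0.
rewrite -(ltr0n R) => l0; rewrite [leLHS]/clen cden_cons cden'_cons.
have h : 0 < th * l%:R * cden w by rewrite !mulr_gt0.
have h2 : 0 < th * cden w by rewrite !mulr_gt0.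
rewrite ler_pdivrMr; last by rewrite mulr_gt0//; lra.
apply: (@le_trans _ _ (th * (2 * m%:R * th * cden w ^+ 2 * clen w))).
  by rewrite -[leLHS]mulr1 ler_pM2l.
have -> : th * (2 * m%:R * th * cden w ^+ 2 * clen w)
   = 2 * m%:R / l%:R ^+2 * clen w * ((th * l%:R * cden w) * (th * l%:R * cden w)).
  by field; rewrite gt_eqF.
apply: ler_wpM2l.
  by apply: mulr_ge0 (clen_ge0 aw); rewrite divr_ge0// exprn_ge0// ltW.
by apply: ler_pM; lra.
Qed.

End Cylinders.

(** * Covering sets of points by cylinders *)

Section Covers.
Variables (R : realType) (m : nat).
Hypothesis m_gt0 : (0 < m)%N.
Local Notation th := (theta R m).
Local Notation T := (@Ttheta R m).
Local Notation cden := (cden R m).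
Local Notation cden' := (cden' R m).
Local Notation cnum := (cnum R m).
Local Notation cnum' := (cnum' R m).
Local Notation clen := (clen R m).
Local Notation leb := (@lebesgue_measure R).

Fixpoint dword (x : R) (n : nat) : seq nat :=
  if n is k.+1 then `|digit m k.+1 x|%N :: dword x k else [::].

Lemma size_dword x n : size (dword x n) = n.
Proof. by elim: n => //= n ->. Qed.

(** Excludes orbits that reach 0: by the convention [0^-1 = 0] all later digits would be 0, which is
    not admissible. *)
Definition infinite_orbit (x : R) := forall k, iter k T x != 0.

(** The number [(th * x)^-1] is at least [m] since [x <= th], and [T x] is [th] times its fractional
    part. *)
Lemma Ttheta_step (x : R) : 0 <= x <= th -> x != 0 ->
  [/\ 0 <= T x <= th, (m <= `|Num.floor ((th * x)^-1)|)%N &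
     x * (th * `|Num.floor ((th * x)^-1)|%N%:R + T x) = 1].
Proof.
move=> /andP[x0 xt] xn0; have t0 := theta_gt0 R m_gt0.
have tm := theta_sqr R m_gt0.
have {}x0 : 0 < x by rewrite lt_neqAle eq_sym xn0.
have tx0 : 0 < th * x by rewrite mulr_gt0.
rewrite /Ttheta (negbTE xn0).
have Mle : m%:R <= (th * x)^-1.
  rewrite -[leRHS]mul1r ler_pdivlMr//.
  apply: (@le_trans _ _ (m%:R * th ^+ 2)); last by rewrite mulrC tm.
  by rewrite expr2 ler_wpM2l// ler_pM2l.
have /andP[] := floor_itv (th * x)^-1.
have mf : (m%:Z <= Num.floor (th * x)^-1) by rewrite floor_ge_int.
have f0 : 0 <= Num.floor (th * x)^-1 by apply: le_trans mf.
have -> : (`|Num.floor (th * x)^-1|%N%:R = (Num.floor (th * x)^-1)%:~R :> R).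
  by rewrite -[in RHS](gez0_abs f0) pmulrn.
rewrite intrD /=; set f : R := _%:~R => f1 f2.
have E : x^-1 = th * (th * x)^-1.
  by field; rewrite xn0 gt_eqF.
split; last by rewrite addrC subrK mulfV.
  rewrite E -mulrBr mulr_ge0 ?subr_ge0 ?(ltW t0)//=.
  by rewrite -[leRHS]mulr1 ler_wpM2l ?(ltW t0)//; lra.
by rewrite -lez_nat gez0_abs.
Qed.

(** The Moebius formula for [x] in terms of its iterate [y], with denominators cleared; the
    induction substitutes [y = 1 / (th * d + z)], where [z] is the next iterate. *)
Lemma dword_orbit (x : R) n : 0 <= x <= th ->
  (forall k, (k < n)%N -> iter k T x != 0) ->
  [/\ 0 <= iter n T x <= th, admissible m (dword x n) &
    x * (cden (dword x n) + iter n T x * cden' (dword x n)) =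
    cnum (dword x n) + iter n T x * cnum' (dword x n)].
Proof.
move=> x0; elim: n => [_|n IH nz].
  by rewrite /= x0 /cden /cden' /cnum /cnum' /= mulr0 addr0 !mulr1 add0r.
have [y0 aw E] := IH (fun k kn => nz k (ltnW kn)).
have yn0 := nz n (leqnn _).
have [z0 dm yE] := Ttheta_step y0 yn0.
rewrite iterS /= aw andbT /digit /=; split=> //.
move: E yE; rewrite /cden /cden' /cnum /cnum' /=.
set y := iter n T x in yn0 *; set z := T y.
set d := (`|_|%N%:R).
move: (contn _ _ _) (contn _ _ _) => [p p'] [q q'] /= E yE.
apply: (mulfI yn0).
have -> : y * (x * (th * d * q + q' + z * q)) =
  x * (y * (th * d + z) * q + y * q') by ring.
have -> : y * (th * d * p + p' + z * p) = y * (th * d + z) * p + y * p' by ring.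
by rewrite yE !mul1r.
Qed.

(* This ball is twice as long as the cylinder; in exchange its endpoints do not
   depend on the parity of the length of [w]. *)
Definition cball (w : seq nat) : set R :=
  `[cnum w / cden w - clen w, cnum w / cden w + clen w]%classic.

Lemma measure_cball w : admissible m w -> leb (cball w) = (2 * clen w)%:E.
Proof.
move=> /(clen_gt0 R m_gt0) l0; rewrite /cball lebesgue_measure_itv/= lte_fin.
rewrite ltrD2l gtrN// -EFinB; congr _%:E; ring.
Qed.

(** The distance from [x] to [cnum w / cden w] is [y / (q * (q + y * q'))], with [y] the [n]-th
    iterate; it increases with [y] and is [clen w] at [y = th]. *)
Lemma dword_cball (x : R) n : 0 <= x <= th ->
  (forall k, (k < n)%N -> iter k T x != 0) -> cball (dword x n) x.
Proof.
move=> x0 nz; have [] := dword_orbit x0 nz.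
set y := iter n T x; set w := dword x n => /andP[y0 yt] aw E.
have [q0 q'0 q'q] := cden_bounds R m_gt0 aw.
have := contn_det R m w.
rewrite /cball /= in_itv /= -ler_distl.
have yq : 0 <= y * cden' w by exact: mulr_ge0.
have qy : 0 < cden w + y * cden' w by lra.
have -> : x = (cnum w + y * cnum' w) / (cden w + y * cden' w).
  by rewrite -E mulfK// gt_eqF.
move=> det1.
have -> : (cnum w + y * cnum' w) / (cden w + y * cden' w) - cnum w / cden w =
   - (y / (cden w * (cden w + y * cden' w))) *
   (cnum w * cden' w - cnum' w * cden w).
  by field; rewrite !gt_eqF.
rewrite normrM det1 mulr1 normrN ger0_norm; last first.
  by rewrite divr_ge0// mulr_ge0 ?ltW.
have tq : 0 <= th * cden' w by rewrite mulr_ge0// ltW// theta_gt0.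
rewrite ler_pdivrMr ?mulr_gt0// /clen mulrAC ler_pdivlMr; last first.
  by rewrite mulr_gt0//; lra.
have h : y * cden w <= th * cden w by rewrite ler_pM2r.
nra.
Qed.

Lemma nneseries_le_bound (s : nat) (f : nat -> R) (M : R) :
  (forall l, (s <= l)%N -> 0 <= f l) ->
  (forall N, \sum_(s <= l < N) f l <= M) ->
  (\sum_(s <= l <oo) (f l)%:E <= M%:E)%E.
Proof.
move=> f0 fM; apply: lime_le.
  by apply: is_cvg_nneseries => l sl _; rewrite lee_fin f0.
by apply: nearW => N; rewrite sumEFin lee_fin.
Qed.

(** A maximal inequality without conditional expectations: [F [::]] bounds the total length of the
    words in [W]. The factor 2 is that of [cball]. *)
Lemma supermartingale_cover (W : seq nat -> Prop) (n : nat) (F : seq nat -> R) :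
  (forall u, admissible m u -> 0 <= F u) ->
  (forall u, admissible m u -> (size u < n)%N -> forall N,
    \sum_(0 <= l < N) F ((m + l)%N :: u) <= F u) ->
  (forall u, admissible m u -> size u = n -> W u -> clen u <= F u) ->
  exists U : set R, [/\ measurable U, (leb U <= (2 * F [::])%:E)%E &
    forall x, 0 <= x <= th -> infinite_orbit x -> W (dword x n) -> U x].
Proof.
move=> F0 FS FW.
(* Induction on the number [k] of digits to be read after the prefix [w]; a cover for [w] is the
   union of the covers for its one-digit extensions. *)
suff H k w : admissible m w -> (size w + k = n)%N ->
  exists U : set R, [/\ measurable U, (leb U <= (2 * F w)%:E)%E &
    forall x, 0 <= x <= th -> infinite_orbit x ->
      dword x (size w) = w -> W (dword x n) -> U x].
  have [U [mU lU UP]] := H n [::] isT erefl.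
  by exists U; split=> // x x0 ix; apply: UP.
elim: k w => [|k IH] w aw sw.
  rewrite addn0 in sw; have [Ww|nWw] := pselect (W w).
    exists (cball w); split.
    - exact: measurable_itv.
    - by rewrite measure_cball// lee_fin ler_wpM2l// FW.
    - by move=> x x0 ix <- _; apply: dword_cball.
  exists set0; split => //; first by rewrite measure0 lee_fin mulr_ge0// F0.
  by move=> x _ _ wE; rewrite -sw wE.
have admS l : admissible m ((m + l)%N :: w) by rewrite /= leq_addr.
have /choice[G GP] : forall l, exists U : set R,
    [/\ measurable U, (leb U <= (2 * F ((m + l)%N :: w))%:E)%E &
    forall x, 0 <= x <= th -> infinite_orbit x ->
      dword x (size w).+1 = (m + l)%N :: w -> W (dword x n) -> U x].
  by move=> l; apply: (IH ((m + l)%N :: w)) => //; rewrite -sw addnS.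
have mG l : measurable (G l) by have [] := GP l.
exists (\bigcup_l G l); split.
- exact: bigcup_measurable.
- have mU : measurable (\bigcup_l G l) by exact: bigcup_measurable.
  have B := @generalized_Boole_inequality _ _ _ (@lebesgue_measure R) G mG mU.
  apply: (le_trans B).
  apply: (@le_trans _ _ (\sum_(0 <= l <oo) (2 * F ((m + l)%N :: w))%:E)%E).
    by apply: lee_nneseries => // l _; have [] := GP l.
  apply: nneseries_le_bound => [l _|N]; first by rewrite mulr_ge0// F0.
  rewrite -mulr_sumr ler_wpM2l// FS//.
  by rewrite -sw addnS ltnS leq_addr.
- move=> x x0 ix wE Wx.
  have [_ adm _] := dword_orbit x0 (fun k (_ : (k < (size w).+1)%N) => ix k).
  move: adm => /=; rewrite wE => /andP[md _].
  exists (`|digit m (size w).+1 x| - m)%N => //.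
  by have [_ _] := GP (`|digit m (size w).+1 x| - m)%N; apply => //=; rewrite subnKC// wE.
Qed.

(** If the [k]-th iterate is the first to vanish, the Moebius formula at 0 makes [x] the convergent
    of its first [k] digits, and words are countable. *)
Lemma finite_orbit_countable :
  countable [set x : R | 0 <= x <= th /\ ~ infinite_orbit x].
Proof.
apply: (@sub_countable _ _ _ (\bigcup_w [set cnum w / cden w])); last first.
  by apply: bigcup_countable => // w _; apply: countable1.
apply: subset_card_le => x [x0].
move=> /existsNP[k0 /negP/negPn k0P].
have ex : exists k, iter k T x == 0 by exists k0.
case: (ex_minnP ex) => k /eqP k0' kmin.
have nz j : (j < k)%N -> iter j T x != 0.
  by move=> jk; apply/negP => /kmin; rewrite leqNgt jk.
have [_ aw] := dword_orbit x0 nz.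
rewrite k0' !mul0r !addr0 => E.
have [q0 _ _] := cden_bounds R m_gt0 aw.
by exists (dword x k) => //; rewrite -E mulfK// gt_eqF.
Qed.

Lemma SsumE (x : R) n : 0 <= x <= th -> infinite_orbit x ->
  Ssum m n x = \sum_(d <- dword x n) d%:R.
Proof.
move=> x0 ix; elim: n => [|n IH]; first by rewrite /Ssum big_geq ?big_nil.
rewrite /Ssum big_nat_recr//= -/(Ssum m n x) IH big_cons addrC; congr (_ + _).
have [y0 _ _] := dword_orbit x0 (fun k (_ : (k < n)%N) => ix k).
rewrite pmulrn gez0_abs// /digit floor_ge0 invr_ge0 mulr_ge0//.
  by rewrite ltW// theta_gt0.
by move: y0 => /andP[].
Qed.

End Covers.

(** * Telescoping over the next digit; words with small digits *)

Section Sums.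
Variables (R : realType) (m : nat).
Hypothesis m_gt0 : (0 < m)%N.
Local Notation th := (theta R m).
Local Notation clen := (clen R m).
Local Notation ctail := (ctail R m).
Local Notation leb := (@lebesgue_measure R).
Local Notation dword := (@dword R m).
Local Notation infinite_orbit := (@infinite_orbit R m).

(** Telescopes by [clen_cons] from [ctail u m = clen u]; [minn] freezes the sum once the digits
    reach [T]. *)
Lemma sum_clen_lt u T N : admissible m u -> (m <= T)%N ->
  \sum_(0 <= l < N) (m + l < T)%N%:R * clen ((m + l)%N :: u) =
  clen u - ctail u (minn (m + N) T).
Proof.
move=> au mT; elim: N => [|N IH].
  by rewrite big_geq// addn0 (minn_idPl mT) ctail_first// subrr.
rewrite big_nat_recr//= IH addnS; case: ltnP => h.
  rewrite mul1r clen_cons//; last by rewrite addn_gt0 m_gt0.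
  rewrite (minn_idPl h); ring.
by rewrite mul0r addr0 (minn_idPr (leqW h)).
Qed.

Lemma sum_clen_ge u T N : admissible m u -> (m <= T)%N ->
  \sum_(0 <= l < N) (T <= m + l)%N%:R * clen ((m + l)%N :: u) <= ctail u T.
Proof.
move=> au mT; suff -> : \sum_(0 <= l < N) (T <= m + l)%N%:R * clen ((m + l)%N :: u) =
    ctail u T - ctail u (maxn (m + N) T) by rewrite gerBl ctail_ge0.
elim: N => [|N IH].
  by rewrite big_geq// addn0 (maxn_idPr mT) subrr.
rewrite big_nat_recr//= IH addnS; case: leqP => h.
  rewrite mul1r clen_cons//; last by rewrite addn_gt0 m_gt0.
  rewrite (maxn_idPl (leqW h)); ring.
by rewrite mul0r addr0 (maxn_idPr h).
Qed.

Lemma sum_clen u N : admissible m u ->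
  \sum_(0 <= l < N) clen ((m + l)%N :: u) = clen u - ctail u (m + N).
Proof.
move=> au; rewrite -[X in ctail u X]minnn -sum_clen_lt ?leq_addr//.
by apply: eq_big_nat => l /andP[_ lN]; rewrite ltn_add2l lN mul1r.
Qed.

Fixpoint digits_below (b : nat -> R) (u : seq nat) : bool :=
  if u is l :: u' then (l%:R < b (size u').+1) && digits_below b u' else true.

Lemma digits_below_cover (b : nat -> R) (n : nat) :
  (forall k, m%:R <= b k.+1) ->
  exists U : set R, [/\ measurable U,
    (leb U <= (2 * (th / (1 + \sum_(0 <= k < n) (3 * b k.+1)^-1)))%:E)%E &
    forall x, 0 <= x <= th -> infinite_orbit x ->
      digits_below b (dword x n) -> U x].
Proof.
move=> mb; set C := fun j : nat => \sum_(0 <= k < j) (3 * b k.+1)^-1.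
have m1 : 1 <= m%:R :> R by rewrite ler1n.
have b1 k : 1 <= b k.+1 by apply: le_trans (mb k).
have C0 j : 0 <= C j.
  by rewrite sumr_ge0// => k _; rewrite invr_ge0 mulr_ge0// (le_trans _ (b1 k)).
(* With [c = (3 * b k.+1)^-1], a word of length [k] survives the next digit with probability at most
   [1 - c], and [(1 - c) * (1 + C k + c) <= 1 + C k]. *)
pose F u := (digits_below b u)%:R * clen u * ((1 + C (size u)) / (1 + C n)).
have Cn : 0 < 1 + C n by rewrite ltr_pwDl.
have FE : F [::] = th / (1 + C n).
  by rewrite /F /= clen_nil /C big_geq// addr0 mul1r div1r.
rewrite -[th / _]FE; apply: (supermartingale_cover m_gt0 (W := digits_below b)).
- move=> u au; apply: mulr_ge0; first by rewrite mulr_ge0// clen_ge0.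
  by rewrite divr_ge0// addr_ge0.
- move=> u au sn N; rewrite /F /=.
  case: (digits_below b u); last first.
    by rewrite !mul0r big1// => l _; rewrite andbF !mul0r.
  set k := size u in sn *; set bk := b k.+1.
  (* A digit below [bk] is below [T], and [T.+1 <= bk + 2 <= 3 * bk], whence the 3 in [C]. *)
  set T := (Num.truncn bk).+1.
  have bk1 : 1 <= bk := b1 k.
  have /andP[Tle ltT] : (Num.truncn bk)%:R <= bk < (Num.truncn bk).+1%:R.
    by apply: truncn_itv; lra.
  have mT : (m <= T)%N by rewrite -(ler_nat R) (le_trans (mb k) (ltW ltT)).
  have tl : (3 * bk)^-1 * clen u <= ctail u T.
    have lo : m%:R / T.+1%:R * clen u <= ctail u T by exact: ctail_ge.
    apply: (le_trans _ lo).
    rewrite ler_wpM2r ?clen_ge0// /T -(natr1 _.+1) -natr1.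
    rewrite -[leLHS]mul1r; apply: ler_pM => //; first by rewrite invr_ge0; lra.
    by rewrite lef_pV2 ?posrE; lra.
  rewrite -mulr_suml mul1r !mulrA ler_pM2r ?invr_gt0//.
  under eq_bigr => l _ do rewrite andbT.
  have CS : C k.+1 = C k + (3 * bk)^-1 by rewrite /C big_nat_recr.
  have S1 : \sum_(0 <= l < N) ((m + l)%:R < bk)%R%:R * clen ((m + l)%N :: u)
      <= clen u - ctail u T.
    apply: (@le_trans _ _ (\sum_(0 <= l < N) (m + l < T)%N%:R * clen ((m + l)%N :: u))).
      apply: ler_sum => l _; rewrite ler_wpM2r//.
        by rewrite clen_ge0//= leq_addr.
      rewrite ler_nat; case: ltrP => // lb.
      by rewrite -(ltr_nat R) (lt_trans lb).
    rewrite sum_clen_lt// lerD2l lerN2 ctail_homo ?inE// ?geq_minr//.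
    by rewrite leq_min /= addn_gt0 m_gt0.
  rewrite CS; have := C0 k; have := clen_ge0 R m_gt0 au.
  have : 0 < (3 * bk)^-1 by rewrite invr_gt0; lra.
  move: ((3 * bk)^-1) (C k) (clen u) (ctail u T) (\sum_(0 <= l < N) _) tl S1.
  move=> c Ck L t S tl S1 c0 L0 Ck0.
  apply: (@le_trans _ _ ((L - c * L) * (1 + (Ck + c)))).
    by rewrite ler_wpM2r//; lra.
  have : 0 <= L * c * (Ck + c) by rewrite !mulr_ge0//; lra.
  lra.
- move=> u au su Wu; rewrite /F su divff ?gt_eqF// mulr1.
  by rewrite Wu mul1r.
Qed.

End Sums.

(** * Divergent series: infinite upper limit *)

Lemma negligible_small_cover (R : realType) (B : set R) :
  (forall e : R, 0 < e -> exists U : set R,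
    [/\ measurable U, (lebesgue_measure U <= e%:E)%E & B `<=` U]) ->
  (@lebesgue_measure R).-negligible B.
Proof.
move=> H; have /choice[U UP] : forall k : nat, exists U : set R,
    [/\ measurable U, (lebesgue_measure U <= (k.+1%:R^-1)%:E)%E & B `<=` U].
  by move=> k; apply: H; rewrite invr_gt0.
have mU k : measurable (U k) by have [] := UP k.
have mI : measurable (\bigcap_k U k) by exact: bigcap_measurable.
exists (\bigcap_k U k); split => //; last first.
  by move=> x Bx k _; have [_ _] := UP k; apply.
apply/eqP; rewrite eq_le measure_ge0 andbT; apply/lee_addgt0Pr => e e0.
rewrite add0e; set k := Num.truncn e^-1.
have [_ lU _] := UP k; apply: (@le_trans _ _ (lebesgue_measure (U k))).
  apply: (@le_measure _ _ _ (@lebesgue_measure R) _ _ (mem_set mI) (mem_set (mU k))).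
  by move=> x; apply.
apply: (le_trans lU); rewrite lee_fin invf_ple ?posrE//.
by apply: ltW; apply: truncnS_gt.
Qed.

(* A real sequence that is unbounded above is so along every tail: events have
   to be shown to occur once, not infinitely often. *)
Lemma limn_esup_unbounded (R : realType) (u : nat -> R) :
  (forall M, exists n, M <= u n) -> limn_esup (fun n => (u n)%:E) = +oo%E.
Proof.
move=> H; rewrite limn_esup_lim.
suff -> : esups (fun n => (u n)%:E) = cst +oo%E by rewrite lim_cst.
apply/funext => n /=; apply/eqyP => A A0.
have [k uk] := H (Num.max A (\sum_(i < n) `|u i| + 1)).
apply: (@le_trans _ _ (u k)%:E).
  by rewrite lee_fin (le_trans _ uk)// le_max lexx.
apply: ereal_sup_ubound; exists k => //=.
rewrite leqNgt; apply/negP => kn; move: uk; rewrite ge_max => /andP[_].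
rewrite (bigD1 (Ordinal kn))//= leNgt => /negP; apply.
have : 0 <= \sum_(i < n | i != Ordinal kn) `|u i| by exact: sumr_ge0.
by have := ler_norm (u k); lra.
Qed.

Section Divergence.
Variables (R : realType) (m : nat) (a : nat -> R).
Hypothesis m_gt0 : (0 < m)%N.
Local Notation th := (theta R m).

Lemma not_digits_below (b : nat -> R) (x : R) (n : nat) :
  ~~ digits_below b (dword m x n) ->
  exists k, b k.+1 <= `|digit m k.+1 x|%N%:R.
Proof.
elim: n => //= n IH; rewrite negb_and => /orP[|/IH//].
by rewrite size_dword -leNgt => h; exists n.
Qed.

Hypothesis a_gt0 : forall n, (0 < n)%N -> 0 < a n.
Hypothesis a_mono : forall n p, (0 < n)%N -> (n <= p)%N ->
  a n / n%:R <= a p / p%:R.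
Hypothesis a_div : (\sum_(1 <= k <oo) ((a k)^-1)%:E = +oo)%E.

Lemma inv_sum_unbounded (M : R) : exists n, M < \sum_(0 <= k < n) (a k.+1)^-1.
Proof.
apply: contrapT => /forallNP H.
suff : (\sum_(1 <= k <oo) ((a k)^-1)%:E <= M%:E)%E by rewrite a_div.
apply: nneseries_le_bound => [l l1|N].
  by rewrite invr_ge0 ltW// a_gt0.
case: N => [|N].
  rewrite big_geq//; have := H 0%N; rewrite big_geq// => /negP.
  by rewrite -leNgt.
by rewrite big_add1 /= leNgt; apply/negP; apply: H.
Qed.

(** The bound on [K] gives [K * a k >= m] for every [k >= 1], as [a] increases with [a k / k]. *)
Lemma digits_below_negligible (K : R) : m%:R / a 1 <= K ->
  (@lebesgue_measure R).-negligible
    [set x | [/\ 0 <= x <= th, infinite_orbit m x &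
      forall n, digits_below (fun k => K * a k) (dword m x n)]].
Proof.
have a1 := a_gt0 (ltn0Sn 0).
move=> mK; have K0 : 0 < K by apply: lt_le_trans mK; rewrite divr_gt0 ?ltr0n.
have mb k : m%:R <= K * a k.+1.
  have : a 1 <= a k.+1.
    have := @a_mono 1 k.+1 isT isT; rewrite divr1 ler_pdivlMr ?ltr0n// => h.
    by apply: le_trans h; rewrite ler_peMr ?ler1n// ltW.
  move=> h; apply: (@le_trans _ _ (K * a 1)); first by rewrite -ler_pdivrMr.
  by rewrite ler_pM2l.
apply: negligible_small_cover => e e0.
(* For this [n] the sum of [(3 * K * a k)^-1] is at least [2 * th / e], so the cover has measure at
   most [e]. *)
have [n Mn] := inv_sum_unbounded (2 * th / e * (3 * K)).
have [U [mU lU UP]] := @digits_below_cover _ _ m_gt0 (fun k => K * a k) n mb.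
exists U; split => //; last by move=> x [x0 ix /(_ n)]; apply: UP.
apply: (le_trans lU); rewrite lee_fin.
set S := \sum_(0 <= k < n) _.
have : 2 * th / e <= S.
  rewrite -(ler_pM2r (_ : 0 < 3 * K)) ?mulr_gt0//.
  apply: (le_trans (ltW Mn)); rewrite /S mulr_suml; apply: ler_sum_nat => k _.
  rewrite mulrA invfM mulrAC mulVf ?mul1r//.
  by rewrite gt_eqF// mulr_gt0.
have t0 : 0 < 2 * th / e by rewrite divr_gt0// mulr_gt0// theta_gt0.
move=> hS; have S0 : 0 < S by apply: lt_le_trans hS.
move: hS; rewrite ler_pdivrMr// => hS.
by rewrite mulrA ler_pdivrMr; lra.
Qed.

(** Off a countable union of null sets, every large integer [K] has some [digit n >= K * a n], and
    one digit already bounds [Ssum m n x] from below. *)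
Lemma limsup_negligible :
  (@lebesgue_measure R).-negligible
    [set x | [/\ 0 <= x <= th, infinite_orbit m x &
      limn_esup (fun n => (Ssum m n x / a n)%:E) <> +oo%E]].
Proof.
set K0 := Num.truncn (m%:R / a 1).
have KP k : m%:R / a 1 <= (K0 + k).+1%:R.
  apply: (le_trans (ltW (truncnS_gt _))).
  by rewrite ler_nat ltnS leq_addr.
apply: negligibleS (negligible_bigcup (fun k => digits_below_negligible (KP k))).
move=> x [x0 ix xb]; apply: contrapT => nb; apply: xb.
apply: limn_esup_unbounded => M.
have : ~ forall n, digits_below (fun j => (K0 + Num.truncn M).+1%:R * a j) (dword m x n).
  by move=> h; apply: nb; exists (Num.truncn M).
move=> /existsNP[n /negP/not_digits_below[k kP]].
have ak := a_gt0 (ltn0Sn k).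
exists k.+1; rewrite ler_pdivlMr//; apply: (@le_trans _ _ `|digit m k.+1 x|%N%:R).
  apply: le_trans kP; rewrite ler_pM2r//.
  apply: (le_trans (ltW (truncnS_gt _))).
  by rewrite ler_nat ltnS leq_addl.
by rewrite SsumE//= big_cons lerDl sumr_ge0.
Qed.

End Divergence.

(** * Truncated digit sums and a quadratic potential *)

Section TruncatedSums.
Variables (R : realType) (m : nat).
Hypothesis m_gt0 : (0 < m)%N.
Local Notation th := (theta R m).
Local Notation clen := (clen R m).
Local Notation ctail := (ctail R m).
Local Notation leb := (@lebesgue_measure R).

Definition harmonic_sum (n : nat) : R := \sum_(1 <= d < n.+1) d%:R^-1.

Lemma harmonic_sum_ge0 n : 0 <= harmonic_sum n.
Proof. by rewrite sumr_ge0// => d _; rewrite invr_ge0. Qed.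

Lemma harmonic_sumS n : harmonic_sum n.+1 = harmonic_sum n + n.+1%:R^-1.
Proof. by rewrite /harmonic_sum big_nat_recr. Qed.

(** A crude bound, enough to make the squared centring [c ^+ 2] of order [t]. *)
Lemma harmonic_sum_sqr n : harmonic_sum n ^+ 2 <= 4 * n%:R.
Proof.
suff : harmonic_sum n <= n%:R /\ harmonic_sum n ^+ 2 <= 4 * n%:R by case.
elim: n => [|n [IH1 IH2]]; first by rewrite /harmonic_sum big_geq// expr0n mulr0.
rewrite harmonic_sumS -natr1.
have n0 : 0 <= n%:R :> R by [].
have i0 : 0 < (n%:R + 1)^-1 :> R by rewrite invr_gt0; lra.
have E : (n%:R + 1)^-1 * (n%:R + 1) = 1 :> R by rewrite mulVf// gt_eqF//; lra.
move: (n%:R) (harmonic_sum n) ((n%:R + 1)^-1) (harmonic_sum_ge0 n) n0 i0 E IH1 IH2.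
move=> x h i h0 x0 i0 E IH1 IH2.
have i1 : i <= 1 by nra.
have hi : h * i <= 1.
  by rewrite -E mulrC ler_wpM2l ?(ltW i0)//; lra.
split; first lra.
have : i * i <= 1 by nra.
rewrite sqrrD; rewrite -mulr_natl; lra.
Qed.

Lemma sum_truncated_le (f : nat -> R) (T N : nat) : (forall d, 0 <= f d) ->
  \sum_(0 <= l < N) (m + l <= T)%N%:R * f (m + l)%N <= \sum_(1 <= d < T.+1) f d.
Proof.
move=> f0.
apply: (@le_trans _ _ (\sum_(1 <= d < minn (m + N) T.+1) f d)).
  elim: N => [|N IH]; first by rewrite big_geq// sumr_ge0.
  rewrite big_nat_recr//= addnS; case: (leqP (m + N) T) => h.
    rewrite minnSS (minn_idPl h) mul1r.
    rewrite (minn_idPl (leqW h)) in IH.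
    by rewrite [leRHS]big_nat_recr ?addn_gt0 ?m_gt0//= lerD2r.
  rewrite mul0r addr0 (minn_idPr (ltnW _)) ?ltnS// -(minn_idPr h).
  exact: IH.
rewrite [leRHS](@big_cat_nat _ _ _ (minn (m + N) T.+1)) ?geq_minr//=.
  by rewrite lerDl sumr_ge0.
by rewrite leq_min /= addn_gt0 m_gt0.
Qed.

(** The right side is the square of [Num.max 0 s + z], which is at least [s + z]. *)
Lemma sqr_maxr0D (s z : R) :
  Num.max 0 (s + z) ^+ 2 <= Num.max 0 s ^+ 2 + 2 * Num.max 0 s * z + z ^+ 2.
Proof. by case: (lerP 0 s) => hs; case: (lerP 0 (s + z)) => hz; nra. Qed.

Variables (t : R).
Hypothesis m_le_t : m%:R <= t.
Let T := Num.truncn t.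
(** Twice the bound of [truncated_mean]; the slack pays for working with partial sums over the next
    digit. *)
Let c := 4 * m%:R * harmonic_sum T.

Definition truncated_digit (d : nat) : R := (d <= T)%N%:R * d%:R.

Local Notation y := truncated_digit.

Definition excess (u : seq nat) : R :=
  \sum_(d <- u) truncated_digit d - c * (size u)%:R.

(** The positive part is taken because [c] exceeds the mean: the downward drift would make the
    square of a negative excess grow. *)
Definition potential (u : seq nat) : R :=
  Num.max 0 (excess u) ^+ 2 + t ^+ 2 * \sum_(d <- u) (T < d)%N%:R.

Lemma potential_ge0 u : 0 <= potential u.
Proof. by rewrite addr_ge0 ?sqr_ge0// mulr_ge0 ?sqr_ge0// sumr_ge0. Qed.

Lemma truncated_digit_ge0 d : 0 <= y d.
Proof. by rewrite mulr_ge0. Qed.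

(** A digit [d] has conditional probability at most [2 * m / d ^+ 2], so it contributes at most
    [2 * m / d]. *)
Lemma truncated_mean u N : admissible m u ->
  \sum_(0 <= l < N) y (m + l)%N * clen ((m + l)%N :: u) <=
  2 * m%:R * harmonic_sum T * clen u.
Proof.
move=> au; have L0 := clen_ge0 R m_gt0 au.
apply: (@le_trans _ _ (\sum_(0 <= l < N)
    (m + l <= T)%N%:R * (2 * m%:R / (m + l)%:R * clen u))).
  apply: ler_sum => l _; rewrite /truncated_digit -mulrA ler_wpM2l//.
  have d0 : (0 < m + l)%N by rewrite addn_gt0 m_gt0.
  have := clen_cons_le R m_gt0 au d0; rewrite -(ltr0n R) in d0.
  move=> /(ler_wpM2l (ltW d0)) h; apply: (le_trans h).
  move: (m + l)%:R d0 => d d0.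
  by rewrite le_eqVlt; apply/orP; left; apply/eqP; field; rewrite gt_eqF.
apply: (le_trans (@sum_truncated_le (fun d => 2 * m%:R / d%:R * clen u) T N _)).
  by move=> d; rewrite mulr_ge0// divr_ge0.
by rewrite -mulr_suml -mulr_sumr.
Qed.

(** Each of the at most [T <= t] digits kept contributes at most [2 * m]. *)
Lemma truncated_second_moment u N : admissible m u ->
  \sum_(0 <= l < N) y (m + l)%N ^+ 2 * clen ((m + l)%N :: u) <=
  2 * m%:R * t * clen u.
Proof.
move=> au; have L0 := clen_ge0 R m_gt0 au.
apply: (@le_trans _ _ (\sum_(0 <= l < N)
    (m + l <= T)%N%:R * (2 * m%:R * clen u))).
  apply: ler_sum => l _; rewrite /truncated_digit.
  case: leqP => _; last by rewrite !mul0r expr0n/= mul0r.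
  rewrite !mul1r.
  have d0 : (0 < m + l)%N by rewrite addn_gt0 m_gt0.
  have := clen_cons_le R m_gt0 au d0; rewrite -(ltr0n R) in d0.
  move=> /(ler_wpM2l (exprn_ge0 2 (ltW d0))) h; apply: (le_trans h).
  move: (m + l)%:R d0 => d d0.
  by rewrite le_eqVlt; apply/orP; left; apply/eqP; field; rewrite gt_eqF.
apply: (le_trans (@sum_truncated_le (fun d => 2 * m%:R * clen u) T N _)).
  by move=> d; rewrite mulr_ge0// divr_ge0.
rewrite sumr_const_nat subn1 /= -(mulr_natr _ T) mulrAC ler_wpM2r// ler_wpM2l//.
by rewrite truncn_le (le_trans _ m_le_t).
Qed.

(** The constant 68 is 64 from [c ^+ 2], 2 from the second moment and 2 from the digits above
    [T]. *)
Lemma potential_step u N : admissible m u ->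
  \sum_(0 <= l < N) clen ((m + l)%N :: u) * potential ((m + l)%N :: u) <=
  clen u * (potential u + 68 * m%:R ^+ 2 * t).
Proof.
move=> au; have L0 := clen_ge0 R m_gt0 au.
have adm l : admissible m ((m + l)%N :: u) by rewrite /= leq_addr.
have m0 : 0 < m%:R :> R by rewrite ltr0n.
have m1 : 1 <= m%:R :> R by rewrite ler1n.
have t0 : 0 < t by apply: lt_le_trans m_le_t.
have /andP[Tle ltT] : T%:R <= t < T.+1%:R by apply: truncn_itv; exact: ltW.
have H0 : 0 <= harmonic_sum T := harmonic_sum_ge0 T.
have c0 : 0 <= c by rewrite mulr_ge0// mulr_ge0.
(* Lengthening the partial sum only increases it, and leaves out a tail [D] of at most half of
   [clen u]. *)
set M := (N + 4 * m)%N.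
apply: (@le_trans _ _ (\sum_(0 <= l < M)
    clen ((m + l)%N :: u) * potential ((m + l)%N :: u))).
  rewrite [leRHS](@big_cat_nat _ _ _ N) ?leq_addr//= lerDl sumr_ge0// => l _.
  by rewrite mulr_ge0 ?potential_ge0 ?clen_ge0.
set S := Num.max 0 (excess u).
set q : R := \sum_(d <- u) (T < d)%N%:R.
have S0 : 0 <= S by rewrite le_max lexx.
(* The part of the expanded potential that does not depend on the new digit. *)
pose A := S ^+ 2 + t ^+ 2 * q + c ^+ 2 - 2 * S * c.
apply: (@le_trans _ _ (\sum_(0 <= l < M)
   (A * clen ((m + l)%N :: u) + 2 * S * (y (m + l)%N * clen ((m + l)%N :: u))
    + y (m + l)%N ^+ 2 * clen ((m + l)%N :: u)
    + t ^+ 2 * ((T.+1 <= m + l)%N%:R * clen ((m + l)%N :: u))))).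
  apply: ler_sum => l _; set d := (m + l)%N; set L := clen (d :: u).
  have L'0 : 0 <= L by exact: (clen_ge0 R m_gt0 (adm l)).
  rewrite -[X in X <= _]mulrC /potential big_cons -/q.
  have -> : excess (d :: u) = excess u + (y d - c).
    by rewrite /excess big_cons /= -natr1; ring.
  have y0 := truncated_digit_ge0 d.
  have P := sqr_maxr0D (excess u) (y d - c); rewrite -/S in P.
  have yc : (y d - c) ^+ 2 <= y d ^+ 2 + c ^+ 2.
    by have : 0 <= y d * c by [exact: mulr_ge0]; nra.
  rewrite -!/(_ < _)%N.
  set e : R := (T < d)%N%:R.
  have -> : A * L + 2 * S * (y d * L) + y d ^+ 2 * L + t ^+ 2 * (e * L) =
     (A + 2 * S * y d + y d ^+ 2 + t ^+ 2 * e) * L by ring.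
  rewrite ler_wpM2r// /A mulrDr; lra.
rewrite !big_split/= -[X in X + _ + _ + _]mulr_sumr -[X in _ + X + _ + _]mulr_sumr.
rewrite -[X in _ + _ + _ + X]mulr_sumr sum_clen//.
have := truncated_mean M au.
have := truncated_second_moment M au.
have mT : (m <= T.+1)%N by rewrite -(ler_nat R) (le_trans m_le_t)// ltW.
have := sum_clen_ge R m_gt0 M au mT.
have := ctail_le R m_gt0 au (ltn0Sn T).
have mM0 : (0 < m + M)%N by rewrite addn_gt0 m_gt0.
have := ctail_le R m_gt0 au mM0.
have := ctail_ge0 R m_gt0 (m + M) au.
move: (\sum_(0 <= l < M) _) (\sum_(0 <= l < M) _) (\sum_(0 <= l < M) _).
move: (ctail u (m + M)) (ctail u T.+1) => D DT s1 s2 s3.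
move=> D0 DL DTL s3T s2L s1L.
have half : D <= clen u / 2.
  apply: (le_trans DL); rewrite mulrC ler_wpM2l// ler_pdivrMr ?ltr0n//.
  have : (m + M)%:R = 5 * m%:R + N%:R :> R
    by rewrite /M (natrD _ m) (natrD _ N) natrM; ring.
  by move=> ->; have : 0 <= N%:R :> R by []; lra.
have tail : t ^+ 2 * s3 <= 2 * m%:R * t * clen u.
  apply: (@le_trans _ _ (t ^+ 2 * (2 * m%:R / T.+1%:R * clen u))).
    by rewrite ler_wpM2l ?sqr_ge0//; apply: le_trans DTL.
  rewrite mulrA ler_wpM2r//.
  have -> : t ^+ 2 * (2 * m%:R / T.+1%:R) = 2 * m%:R * t * (t / T.+1%:R) by ring.
  rewrite ler_piMr ?mulr_ge0 ?(ltW t0)//.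
  by rewrite ler_pdivrMr ?ltr0n// mul1r ltW.
have cc : c ^+ 2 <= 64 * m%:R ^+ 2 * t.
  rewrite /c exprMn; have := harmonic_sum_sqr T => h.
  apply: (@le_trans _ _ ((4 * m%:R) ^+ 2 * (4 * t))).
    by rewrite ler_wpM2l ?sqr_ge0//; lra.
  by rewrite le_eqVlt; apply/orP; left; apply/eqP; ring.
(* The linear term is cancelled by the centring: [s1 <= c * clen u / 2 <= c * (clen u - D)]. *)
have drift : 2 * S * s1 <= 2 * S * c * (clen u - D).
  rewrite -[leRHS]mulrA ler_wpM2l ?mulr_ge0//.
  apply: (le_trans s1L); apply: (@le_trans _ _ (c * (clen u / 2))).
    by rewrite /c le_eqVlt; apply/orP; left; apply/eqP; field.
  by rewrite ler_wpM2l//; lra.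
have B0 : 0 <= S ^+ 2 + t ^+ 2 * q + c ^+ 2.
  by rewrite !addr_ge0 ?sqr_ge0// mulr_ge0 ?sqr_ge0// sumr_ge0.
have B1 : (S ^+ 2 + t ^+ 2 * q + c ^+ 2) * (clen u - D) <=
    (S ^+ 2 + t ^+ 2 * q + c ^+ 2) * clen u by rewrite ler_wpM2l//; lra.
have cL : c ^+ 2 * clen u <= 64 * m%:R ^+ 2 * t * clen u by rewrite ler_wpM2r.
have mm : m%:R * t * clen u <= m%:R ^+ 2 * t * clen u.
  by rewrite expr2 !ler_wpM2r ?(ltW t0)// ler_peMr// ltW.
rewrite /potential -/S -/q /A; lra.
Qed.

(** Markov's inequality: [F] adds to the potential the allowance [V] for each digit to come. Here
    136 is twice 68. *)
Lemma potential_cover (n : nat) (eta : R) : 0 < eta ->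
  exists U : set R, [/\ measurable U,
    (leb U <= (136 * m%:R ^+ 2 * n%:R / (eta * t))%:E)%E &
    forall x, 0 <= x <= th -> infinite_orbit m x ->
      eta * t ^+ 2 <= potential (dword m x n) -> U x].
Proof.
move=> e0; have t0 : 0 < t by apply: lt_le_trans m_le_t; rewrite ltr0n.
pose V := 68 * m%:R ^+ 2 * t.
have V0 : 0 <= V by rewrite mulr_ge0 ?(ltW t0)// mulr_ge0 ?sqr_ge0.
have et0 : 0 < eta * t ^+ 2 by rewrite mulr_gt0 ?exprn_gt0.
pose F u := clen u * (potential u + (n - size u)%:R * V) / (eta * t ^+ 2).
have F0 u : admissible m u -> 0 <= F u.
  move=> au; rewrite divr_ge0 ?(ltW et0)// mulr_ge0 ?clen_ge0//.
  by rewrite addr_ge0 ?potential_ge0// mulr_ge0.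
have [||U [mU lU UP]] := @supermartingale_cover _ _ m_gt0
    (fun u => eta * t ^+ 2 <= potential u) n F F0.
- move=> u au sn N; rewrite /F -mulr_suml ler_wpM2r ?invr_ge0 ?(ltW et0)//=.
  under eq_bigr => l _ do rewrite mulrDr.
  rewrite big_split/= -mulr_suml sum_clen//.
  have := potential_step N au; rewrite -/V.
  have -> : (n - size u)%:R = (n - (size u).+1)%:R + 1 :> R.
    by rewrite natr1 -subSn// subSS.
  have : 0 <= ctail u (m + N) * ((n - (size u).+1)%:R * V).
    by rewrite mulr_ge0 ?ctail_ge0// mulr_ge0.
  lra.
- move=> u au su Wu; rewrite /F ler_pdivlMr// ler_wpM2l ?clen_ge0//.
  by rewrite su subnn mul0r addr0.
- exists U; split => //; apply: (le_trans lU); rewrite lee_fin.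
  rewrite /F /potential /excess big_nil /= clen_nil subn0 big_nil.
  rewrite mulr0 subrr maxxx expr0n /= mulr0 !add0r.
  have -> : 2 * (th * (n%:R * V) / (eta * t ^+ 2)) =
     th * (136 * m%:R ^+ 2 * n%:R / (eta * t)).
    by rewrite /V; field; rewrite !gt_eqF.
  rewrite ler_piMl ?theta_le1// divr_ge0 ?mulr_ge0 ?sqr_ge0 ?(ltW e0) ?(ltW t0)//.
Qed.

(** Either no digit exceeds [T] and the excess is at least [delta / 2 * t], or one does and adds
    [t ^+ 2] to the potential. *)
Lemma digit_sum_cover (n : nat) (delta : R) : 0 < delta ->
  c * n%:R <= delta / 2 * t ->
  exists U : set R, [/\ measurable U,
    (leb U <= (136 * m%:R ^+ 2 * n%:R / (Num.min 1 (delta ^+ 2 / 4) * t))%:E)%E &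
    forall x, 0 <= x <= th -> infinite_orbit m x ->
      delta * t < \sum_(d <- dword m x n) d%:R -> U x].
Proof.
move=> d0 cn; have t0 : 0 < t by apply: lt_le_trans m_le_t; rewrite ltr0n.
have e0 : 0 < Num.min 1 (delta ^+ 2 / 4).
  by rewrite lt_min ltr01 divr_gt0// exprn_gt0.
have [U [mU lU UP]] := potential_cover n e0.
exists U; split => // x x0 ix big; apply: UP => //.
move: (dword m x n) (size_dword m x n) big => u su big.
rewrite /potential; have [allT|/allPn[d du dT]] := boolP (all (fun d => d <= T)%N u).
  have E : \sum_(d <- u) y d = \sum_(d <- u) d%:R.
    apply: eq_big_seq => d du; rewrite /truncated_digit.
    by rewrite (allP allT d du) mul1r.
  have ex : delta / 2 * t <= excess u by rewrite /excess E su; lra.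
  have h : (delta / 2 * t) ^+ 2 <= Num.max 0 (excess u) ^+ 2.
    rewrite ler_sqr ?nnegrE ?le_max ?lexx ?ex ?orbT//.
    by rewrite mulr_ge0 ?(ltW t0)// ltW// divr_gt0.
  apply: ler_wpDr; first by rewrite mulr_ge0 ?sqr_ge0// sumr_ge0.
  apply: le_trans h; rewrite exprMn ler_wpM2r ?sqr_ge0//.
  by rewrite ge_min expr_div_n -natrX lexx orbT.
apply: ler_wpDl; first exact: sqr_ge0.
rewrite mulrC ler_wpM2l ?sqr_ge0//; apply: (@le_trans _ _ 1).
  by rewrite ge_min lexx.
rewrite (big_rem d)//= ltnNge dT lerDl sumr_ge0//.
Qed.

End TruncatedSums.

(** * Convergent series: dyadic blocks and Borel-Cantelli *)

(** For [j >= 2 * i] the terms from [i] to [j] number at least [j / 2], each at least [r j], and sum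
    to less than [e / 2]. *)
Lemma summable_noninc_small (R : realType) (r : nat -> R) (M : R) :
  (forall j, 0 <= r j) -> (forall i j, (i <= j)%N -> r j <= r i) ->
  (forall J, \sum_(0 <= j < J) r j <= M) ->
  forall e, 0 < e -> exists J, forall j, (J <= j)%N -> j%:R * r j <= e.
Proof.
move=> r0 rdec rM e e0.
pose u J := \sum_(0 <= j < J) r j.
have ub : has_sup (range u).
  split; first by exists (u 0%N), 0%N.
  by exists M => _ [J _ <-]; apply: rM.
have e2 : 0 < e / 2 by rewrite divr_gt0.
have [_ [i _ <-] ui] := sup_adherent e2 ub.
exists (2 * i)%N => j ij.
have uj : u j.+1 <= sup (range u) by apply: sup_upper_bound => //; exists j.+1.
have ile : (i <= j.+1)%N by lia.
have E : u j.+1 = u i + \sum_(i <= k < j.+1) r k.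
  by rewrite /u (@big_cat_nat _ _ _ i).
have : \sum_(i <= k < j.+1) r j <= \sum_(i <= k < j.+1) r k.
  by apply: ler_sum_nat => k /andP[_ kj]; apply: rdec.
rewrite sumr_const_nat -(mulr_natl _ (j.+1 - i)) => h.
have : j%:R / 2 * r j <= (j.+1 - i)%:R * r j.
  rewrite ler_wpM2r// natrB// -[j.+1%:R]natr1.
  have : (2 * i)%:R <= j%:R :> R by rewrite ler_nat.
  by rewrite natrM; lra.
lra.
Qed.

(** Each block of indices from [2 ^ i + 1] to [2 ^ i.+1] adds at most 1. *)
Lemma harmonic_sum_pow2 (R : realType) i : harmonic_sum R (2 ^ i) <= i.+1%:R.
Proof.
elim: i => [|i IH]; first by rewrite /harmonic_sum big_nat1 invr1.
rewrite /harmonic_sum (@big_cat_nat _ _ _ (2 ^ i).+1)//=; last first.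
  by rewrite ltnS leq_exp2l.
rewrite -[i.+2%:R]natr1; apply: lerD => //.
apply: (@le_trans _ _ (\sum_((2 ^ i).+1 <= d < (2 ^ i.+1).+1) (2 ^ i)%:R^-1)).
  apply: ler_sum_nat => d /andP[d1 _]; rewrite lef_pV2 ?posrE ?ltr0n ?expn_gt0//.
    by rewrite ler_nat ltnW.
  by apply: leq_ltn_trans d1.
by rewrite sumr_const_nat subSS expnS mul2n -addnn addnK -[X in X <= _]mulr_natl divff//.
Qed.

Lemma harmonic_sum_homo (R : realType) :
  {homo harmonic_sum R : i j / (i <= j)%N >-> i <= j}.
Proof.
move=> i j ij; rewrite /harmonic_sum [leRHS](@big_cat_nat _ _ _ i.+1)//=.
by rewrite lerDl sumr_ge0// => d _; rewrite invr_ge0.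
Qed.

Section Convergence.
Variables (R : realType) (m : nat) (a : nat -> R).
Hypothesis m_gt0 : (0 < m)%N.
Local Notation th := (theta R m).
Local Notation leb := (@lebesgue_measure R).

Hypothesis a_gt0 : forall n, (0 < n)%N -> 0 < a n.
Hypothesis a_mono : forall n p, (0 < n)%N -> (n <= p)%N ->
  a n / n%:R <= a p / p%:R.
Hypothesis a_conv : (\sum_(1 <= k <oo) ((a k)^-1)%:E < +oo)%E.

Lemma a_homo n p : (0 < n)%N -> (n <= p)%N -> a n <= a p.
Proof.
move=> n0 np; have p0 : (0 < p)%N by apply: leq_trans np.
have := a_mono n0 np; rewrite ler_pdivrMr ?ltr0n// mulrAC => h.
apply: (le_trans h); rewrite -mulrA ler_piMr ?(ltW (a_gt0 p0))//.
by rewrite ler_pdivrMr ?ltr0n// mul1r ler_nat.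
Qed.

Lemma inv_sum_bounded : exists M, forall n, \sum_(1 <= k < n) (a k)^-1 <= M.
Proof.
have a0 k : (1 <= k)%N -> xpredT k -> (0 <= ((a k)^-1)%:E)%E.
  by move=> k1 _; rewrite lee_fin invr_ge0 ltW// a_gt0.
have F : (\sum_(1 <= k <oo) ((a k)^-1)%:E)%E \is a fin_num.
  by rewrite ge0_fin_numE// nneseries_ge0.
exists (fine (\sum_(1 <= k <oo) ((a k)^-1)%:E)%E) => n.
by rewrite -lee_fin fineK// -sumEFin; apply: nneseries_lim_ge.
Qed.

(* The reciprocal of min (a (2 ^ j)) (4 ^ j) / 2 ^ j: capping a at n ^ 2 keeps
   the truncation level polynomial, so that its harmonic sum is O(j). *)
Definition dyadic_ratio (j : nat) : R :=
  Num.max ((2 ^ j)%:R / a (2 ^ j)) (2 ^ j)%:R^-1.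

Local Notation r := dyadic_ratio.

Lemma dyadic_ratio_gt0 j : 0 < r j.
Proof. by rewrite lt_max invr_gt0 ltr0n expn_gt0 orbT. Qed.

Lemma dyadic_ratio_noninc i j : (i <= j)%N -> r j <= r i.
Proof.
move=> ij; have p0 k : (0 < 2 ^ k)%N by rewrite expn_gt0.
have le2 : (2 ^ i <= 2 ^ j)%N by rewrite leq_exp2l.
rewrite /dyadic_ratio ge_max !le_max; apply/andP; split; apply/orP.
  left; rewrite -[leLHS]invf_div -[leRHS]invf_div.
  by rewrite lef_pV2 ?posrE ?divr_gt0 ?a_gt0 ?ltr0n// a_mono.
by right; rewrite lef_pV2 ?posrE ?ltr0n// ler_nat.
Qed.

(** Cauchy condensation. *)
Lemma dyadic_sum_le J :
  \sum_(0 <= j < J) ((2 ^ j.+1)%:R / a (2 ^ j.+1)) <=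
  2 * \sum_(1 <= k < (2 ^ J).+1) (a k)^-1.
Proof.
elim: J => [|J IH].
  by rewrite big_geq// big_nat1 mulr_ge0// invr_ge0 ltW// a_gt0.
rewrite big_nat_recr//= [X in _ <= 2 * X](@big_cat_nat _ _ _ (2 ^ J).+1)//=; last first.
  by rewrite ltnS leq_exp2l.
rewrite mulrDr; apply: lerD => //.
have p0 : (0 < 2 ^ J.+1)%N by rewrite expn_gt0.
apply: (@le_trans _ _ (2 * \sum_((2 ^ J).+1 <= k < (2 ^ J.+1).+1) (a (2 ^ J.+1))^-1)).
  have E : (2 ^ J.+1 - 2 ^ J = 2 ^ J)%N by rewrite expnS mul2n -addnn addnK.
  by rewrite sumr_const_nat subSS E -[X in 2 * X]mulr_natl mulrA -natrM -expnS.
rewrite ler_pM2l//; apply: ler_sum_nat => k /andP[k1 k2].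
have k0 : (0 < k)%N by apply: leq_ltn_trans k1.
by rewrite lef_pV2 ?posrE ?a_gt0// a_homo.
Qed.

Lemma sum_inv_pow2 J : \sum_(0 <= j < J) (2 ^ j)%:R^-1 <= 2 :> R.
Proof.
suff : \sum_(0 <= j < J) (2 ^ j)%:R^-1 <= 2 - (2 ^ J)%:R^-1 * 2 :> R.
  by have : 0 <= (2 ^ J)%:R^-1 :> R by []; lra.
elim: J => [|J IH]; first by rewrite big_geq// expn0 invr1; lra.
rewrite big_nat_recr//= expnS natrM invfM.
by move: IH; move: ((2 ^ J)%:R^-1) => x; lra.
Qed.

Lemma dyadic_ratio_summable : exists M, forall J, \sum_(0 <= j < J) r j <= M.
Proof.
have [M HM] := inv_sum_bounded.
exists ((a 1)^-1 + 2 * M + 2) => J.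
apply: (@le_trans _ _ (\sum_(0 <= j < J) ((2 ^ j)%:R / a (2 ^ j) + (2 ^ j)%:R^-1))).
  apply: ler_sum => j _; rewrite ge_max lerDl lerDr invr_ge0 ler0n/=.
  by rewrite divr_ge0// ltW// a_gt0// expn_gt0.
rewrite big_split/=; apply: lerD; last exact: sum_inv_pow2.
have a1 : 0 <= (a 1)^-1 by rewrite invr_ge0 ltW// a_gt0.
case: J => [|J].
  rewrite big_geq// addr_ge0// mulr_ge0//.
  by have := HM 0%N; rewrite big_geq.
rewrite big_nat_recl//= expn0 mul1r; apply: lerD => //.
apply: (le_trans (dyadic_sum_le J)).
by rewrite ler_pM2l.
Qed.

(** This is the minimum of [a (2 ^ j)] and [4 ^ j]. *)
Definition dyadic_level (j : nat) : R := (2 ^ j)%:R / r j.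

Lemma dyadic_level_le_a j : dyadic_level j <= a (2 ^ j).
Proof.
have aj : 0 < a (2 ^ j) by rewrite a_gt0// expn_gt0.
rewrite /dyadic_level ler_pdivrMr ?dyadic_ratio_gt0// -ler_pdivrMl//.
by rewrite mulrC le_max lexx.
Qed.

Lemma dyadic_level_le j : dyadic_level j <= (2 ^ (j + j))%:R.
Proof.
rewrite /dyadic_level ler_pdivrMr ?dyadic_ratio_gt0// -ler_pdivrMl ?ltr0n ?expn_gt0//.
by rewrite expnD natrM invfM -mulrA mulVf ?mulr1 ?le_max ?lexx ?orbT// pnatr_eq0 expn_eq0.
Qed.

Lemma dyadic_block_negligible (delta : R) : 0 < delta ->
  leb.-negligible [set x | [/\ 0 <= x <= th, infinite_orbit m x &
    forall J, exists2 j, (J <= j)%N &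
      delta * dyadic_level j < Ssum m (2 ^ j.+1) x]].
Proof.
move=> d0; have [M rM] := dyadic_ratio_summable.
have r0 j : 0 <= r j := ltW (dyadic_ratio_gt0 j).
have m0 : 0 < m%:R :> R by rewrite ltr0n.
(* The centring condition of [digit_sum_cover] reads [4 * m * (3 * j) * (2 * 2 ^ j) <= delta / 2 *
   (2 ^ j / r j)], that is [48 * m * (j * r j) <= delta]. *)
pose e := Num.min 1 (delta / (48 * m%:R)).
have e0 : 0 < e by rewrite lt_min ltr01 divr_gt0// mulr_gt0.
have [J0 HJ0] := summable_noninc_small r0 dyadic_ratio_noninc rM e0.
(* Adding [m] ensures [j >= 1] and [m <= 2 ^ j] in all blocks considered. *)
pose J := (J0 + m)%N.
pose eta := Num.min 1 (delta ^+ 2 / 4).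
have eta0 : 0 < eta by rewrite lt_min ltr01 divr_gt0// exprn_gt0.
(* 272 is twice 136, as a block has [2 ^ j.+1] digits. *)
pose C := 272 * m%:R ^+ 2 / eta.
have /choice[U UP] : forall k, exists U : set R, [/\ measurable U,
    (leb U <= (C * r (J + k)%N)%:E)%E &
    forall x, 0 <= x <= th -> infinite_orbit m x ->
      delta * dyadic_level (J + k) < Ssum m (2 ^ (J + k).+1) x -> U x].
  move=> k; set j := (J + k)%N.
  have j1 : 1 <= j%:R :> R by rewrite ler1n; lia.
  have rj := HJ0 j (leq_trans (leq_addr _ _) (leq_addr _ _)).
  have rj0 : 0 < r j := dyadic_ratio_gt0 j.
  have rj1 : j%:R * r j <= 1 by apply: (le_trans rj); rewrite ge_min lexx.
  have rjd : 48 * m%:R * (j%:R * r j) <= delta.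
    rewrite mulrC -ler_pdivlMr ?mulr_gt0//.
    by apply: (le_trans rj); rewrite ge_min lexx orbT.
  have rle1 : r j <= 1 by apply: le_trans rj1; rewrite ler_peMl// ltW.
  have p0 : 0 < (2 ^ j)%:R :> R by rewrite ltr0n expn_gt0.
  have t2 : (2 ^ j)%:R <= dyadic_level j.
    by rewrite /dyadic_level ler_pdivlMr// ler_piMr// ltW.
  have mt : m%:R <= dyadic_level j.
    apply: le_trans t2; rewrite ler_nat (leq_trans _ (ltnW (ltn_expl _ _)))//.
    by rewrite /j /J; lia.
  have t0 : 0 < dyadic_level j by apply: lt_le_trans mt.
  (* The level is at most [2 ^ (j + j)], so the harmonic sum is at most [2 * j + 1]. *)
  have H2 : harmonic_sum R (Num.truncn (dyadic_level j)) <= 3 * j%:R.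
    apply: (@le_trans _ _ (harmonic_sum R (2 ^ (j + j)))).
      apply: harmonic_sum_homo; rewrite truncn_le_nat.
      by apply: le_lt_trans (dyadic_level_le j) _; rewrite ltr_nat.
    apply: (le_trans (harmonic_sum_pow2 R _)).
    by rewrite -natr1 natrD; lra.
  have cn : 4 * m%:R * harmonic_sum R (Num.truncn (dyadic_level j)) *
      (2 ^ j.+1)%:R <= delta / 2 * dyadic_level j.
    rewrite expnS natrM /dyadic_level.
    apply: (@le_trans _ _ (4 * m%:R * (3 * j%:R) * (2 * (2 ^ j)%:R))).
      by rewrite ler_wpM2r ?mulr_ge0 ?(ltW p0)// ler_wpM2l// mulr_ge0// ltW.
    rewrite [leRHS]mulrA ler_pdivlMr//.
    have -> : 4 * m%:R * (3 * j%:R) * (2 * (2 ^ j)%:R) * r j =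
      48 * m%:R * (j%:R * r j) * (2 ^ j)%:R / 2 by field.
    by rewrite [leRHS]mulrAC ler_pM2r ?invr_gt0// ler_pM2r.
  have [U [mU lU UP]] := digit_sum_cover m_gt0 mt d0 cn.
  exists U; split => //.
    apply: (le_trans lU); rewrite lee_fin -/eta /C /dyadic_level expnS natrM.
    by rewrite le_eqVlt; apply/orP; left; apply/eqP; field; rewrite !gt_eqF.
  by move=> x x0 ix; rewrite SsumE//; apply: UP.
have mU k : measurable (U k) by have [] := UP k.
have C0 : 0 <= C by rewrite divr_ge0 ?(ltW eta0)// mulr_ge0 ?sqr_ge0.
exists (lim_sup_set U); split.
- apply: bigcapT_measurable => n; apply: bigcup_measurable => j _; exact: mU.
- apply: lim_sup_set_cvg0 => //.
  apply: (@le_lt_trans _ _ (C * M)%:E); last exact: ltry.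
  apply: (@le_trans _ _ (\sum_(0 <= k <oo) (C * r (J + k)%N)%:E)%E).
    by apply: lee_nneseries => // k _; have [] := UP k.
  apply: nneseries_le_bound => [k _|N]; first by rewrite mulr_ge0.
  rewrite -mulr_sumr ler_wpM2l//; apply: le_trans (rM (J + N)%N).
  have -> : \sum_(0 <= k < N) r (J + k)%N = \sum_(J <= i < J + N) r i.
    rewrite -{2}[J]add0n big_addn addKn.
    by apply: eq_bigr => i _; rewrite addnC.
  by rewrite [leRHS](@big_cat_nat _ _ _ J) ?leq_addr//= lerDr sumr_ge0.
- move=> x [x0 ix Hx] n _; have [j jn Sj] := Hx (J + n)%N.
  have Jj : (J <= j)%N by apply: leq_trans jn; apply: leq_addr.
  exists (j - J)%N; first by rewrite /= leq_subRL// addnC.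
  by have [_ _] := UP (j - J)%N; apply => //; rewrite subnKC.
Qed.

Lemma Ssum_homo (x : R) n p : 0 <= x <= th -> infinite_orbit m x ->
  (n <= p)%N -> Ssum m n x <= Ssum m p x.
Proof.
move=> x0 ix; elim: p => [|p IH]; first by rewrite leqn0 => /eqP->.
rewrite leq_eqVlt => /orP[/eqP->//|/IH h]; apply: (le_trans h).
by rewrite !SsumE//= big_cons lerDr.
Qed.

(** For [2 ^ j <= n < 2 ^ j.+1], monotonicity compares [Ssum m n x] with the sum at [2 ^ j.+1] and
    [a n] with [a (2 ^ j)]; countably many [delta] suffice. *)
Lemma cvg_negligible :
  leb.-negligible [set x | [/\ 0 <= x <= th, infinite_orbit m x &
    ~ (fun n : nat => Ssum m n x / a n) @ \oo --> (0 : R)]].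
Proof.
have i0 p : 0 < p.+1%:R^-1 :> R by rewrite invr_gt0.
apply: negligibleS (negligible_bigcup (fun p => dyadic_block_negligible (i0 p))).
move=> x [x0 ix xb]; apply: contrapT => nb; apply: xb.
apply/cvgr0Pnorm_le => e e0; pose p := Num.truncn e^-1.
have pe : p.+1%:R^-1 <= e.
  by rewrite invf_ple ?posrE//; apply: ltW; apply: truncnS_gt.
have [J HJ] : exists J, forall j, (J <= j)%N ->
    Ssum m (2 ^ j.+1) x <= p.+1%:R^-1 * dyadic_level j.
  apply: contrapT => /forallNP H; apply: nb; exists p => //; split => // J.
  have /existsNP[j /not_implyP[Jj /negP]] := H J.
  by rewrite -ltNge => h; exists j.
exists (2 ^ J)%N => // n /= Jn.
have n0 : (0 < n)%N by apply: leq_trans Jn; rewrite expn_gt0.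
have an := a_gt0 n0.
have /andP[jn nj] := @trunc_log_bounds 2 n isT n0.
set j := trunc_log 2 n in jn nj.
have Jj : (J <= j)%N by rewrite -ltnS -(@ltn_exp2l 2)// (leq_ltn_trans Jn).
have S0 : 0 <= Ssum m n x by rewrite SsumE// sumr_ge0.
rewrite ger0_norm; last by rewrite divr_ge0// ltW.
rewrite ler_pdivrMr//; apply: (le_trans (Ssum_homo x0 ix (ltnW nj))).
apply: (le_trans (HJ j Jj)); apply: ler_pM => //.
  by rewrite divr_ge0// ltW// dyadic_ratio_gt0.
apply: (le_trans (dyadic_level_le_a j)).
by apply: a_homo => //; rewrite expn_gt0.
Qed.

End Convergence.

(** * Null sets and conclusion *)

Lemma finite_orbit_negligible (R : realType) (m : nat) : (0 < m)%N ->
  (@lebesgue_measure R).-negligible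
    [set x | 0 <= x <= theta R m /\ ~ infinite_orbit m x].
Proof.
move=> m0; have c := finite_orbit_countable R m0.
exists [set x : R | 0 <= x <= theta R m /\ ~ infinite_orbit m x]; split => //.
- by apply: countable_measurable c => t; apply: measurable_set1.
- exact: countable_lebesgue_measure0.
Qed.

Lemma gamma_theta_null (R : realType) (m : nat) (N : set R) : (0 < m)%N ->
  measurable N -> lebesgue_measure N = 0%E -> gamma_theta m N = 0%E.
Proof.
move=> m0 mN N0; have t0 := theta_gt0 R m0; have t1 := theta_le1 R m0.
have mI : measurable (N `&` `[0, theta R m]%classic).
  by apply: measurableI => //; apply: measurable_itv.
apply: null_set_integral => //.
- apply/measurable_EFinP.

  (* Measurability follows from continuity on an open interval containing [[0, theta R m]] where
     [1 + theta R m * x] stays positive. *)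
  apply: (@measurable_funS _ _ (measurableTypeR R) _ `]-1, 2[%classic) => //.
    move=> x [_] /=; rewrite !in_itv/= => /andP[x0 xt].
    by apply/andP; split; lra.
  apply: open_continuous_measurable_fun => // x; rewrite inE /= in_itv/=.
  move=> /andP[x1 _]; rewrite /gamma_density.
  apply: cvgM; first exact: cvg_cst.
  apply: cvgM; first exact: cvg_cst.
  apply: cvgV; first by rewrite gt_eqF//; nra.
  apply: cvgD; first exact: cvg_cst.
  by apply: cvgM; [exact: cvg_cst|exact: cvg_id].
- apply/eqP; rewrite eq_le measure_ge0 andbT -N0.
  apply: (@le_measure _ _ _ (@lebesgue_measure R) _ _ (mem_set mI) (mem_set mN)).
  exact: subIsetl.
Qed.

Unset Implicit Arguments.
Set Strict Implicit.

Theorem theorem1p7 (R : realType) (m : nat) (a : nat -> R) :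
  (0 < m)%N -> (forall k : nat, m != (k * k)%N) ->
  (forall n : nat, (0 < n)%N -> 0 < a n) ->
  (forall n p : nat, (0 < n)%N -> (n <= p)%N -> a n / n%:R <= a p / p%:R) ->
  gamma_ae m (fun x : R =>
    ((\sum_(1 <= k <oo) ((a k)^-1)%:E < +oo)%E ->
       (fun n : nat => Ssum m n x / a n) @ \oo --> (0 : R)) /\
    ((\sum_(1 <= k <oo) ((a k)^-1)%:E = +oo)%E ->
       limn_esup (fun n => (Ssum m n x / a n)%:E) = +oo%E)).
Proof.
move=> m0 _ a0 am; set S := (\sum_(1 <= k <oo) _)%E.
suff /(negligibleU (finite_orbit_negligible R m0))[N [mN N0 NP]] :
  (@lebesgue_measure R).-negligible
    [set x | [/\ 0 <= x <= theta R m, infinite_orbit m x &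
      ~ ((S < +oo)%E -> (fun n : nat => Ssum m n x / a n) @ \oo --> (0 : R)) \/
      ~ (S = +oo%E -> limn_esup (fun n => (Ssum m n x / a n)%:E) = +oo%E)]].
  exists N; split => //; first exact: gamma_theta_null.
  move=> x [] /=; rewrite in_itv/= => x0 /not_andP Px; apply: NP.
  by have [ix|nix] := pselect (infinite_orbit m x); [right|left].
(* The series does not depend on [x], so in each case one of the two implications is vacuous for all
   points at once. *)
have [Soo|Sfin] := eqVneq S +oo%E.
  apply: negligibleS (limsup_negligible m0 a0 am Soo).
  by move=> x [x0 ix [] /not_implyP[]]; rewrite Soo ?ltxx.
apply: negligibleS (cvg_negligible m0 a0 am _); last by rewrite -/S ltey.
move=> x [x0 ix [] /not_implyP[]// Soo].
by move: Sfin; rewrite Soo eqxx.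
Qed.
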